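(* Let $(M,\mathcal E,\mathfrak m)$ be a quasi-regular, strongly local Dirichlet space and let $\mu$ be an $\mathcal E$-dominant Borel measure on $M$. Let $(\mathcal M,\mathbf d)$ be a tuple consisting of an $L^2$-normed $L^\infty$-module $\mathcal M$ over $M$ with respect to $\mu$, with pointwise norm denoted by ${}_\mu|\cdot|$, and a linear map $\mathbf d:\mathcal F_e\to\mathcal M$ such that (a) $\mathcal M$ is generated by $\mathbf d\,\mathcal F_e$, and (b) for every $f\in\mathcal F_e$, ${}_\mu|\mathbf df|=\Gamma_\mu(f)^{1/2}$ $\mu$-a.e. Then there exists a unique module isomorphism $\Phi:L^2(T^*M)\to\mathcal M$ such that $$\Phi\circ d=\mathbf d.$$
   Context: Dirichlet space. $M$ is a topological Lusin space (a continuous injective image of a Polish space) with a $\sigma$-finite Borel measure $\mathfrak m$ of full topological support. $(\mathcal E,\mathcal F)$ is a symmetric, quasi-regular, strongly local Dirichlet form on $L^2(M,\mathfrak m)$ with dense domain $\mathcal F$; $\mathcal E(f):=\mathcal E(f,f)$. The extended domain $\mathcal F_e$ is the set of ($\mathfrak m$-a.e. classes of) measurable $f:M\to\mathbb R$ that are $\mathfrak m$-a.e. limits of sequences $(f_n)$ in $\mathcal F$ with $\mathcal E(f_n-f_m)\to0$; $\mathcal E(f):=\lim_n\mathcal E(f_n)$. Every $f\in\mathcal F_e$ has an $\mathcal E$-quasi-continuous version $\tilde f$. The energy measure is the symmetric bilinear map, denoted $\boldsymbol\mu$, on $\mathcal F_e\times\mathcal F_e$ with values in finite signed Radon measures charging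 no $\mathcal E$-polar sets determined by $2\int_M\tilde h\,d\boldsymbol\mu_{f,g}=\mathcal E(fh,g)+\mathcal E(gh,f)-\mathcal E(fg,h)$ for bounded $f,g,h\in\mathcal F$ and extended to $\mathcal F_e$ by approximation; $\boldsymbol\mu_f:=\boldsymbol\mu_{f,f}\ge0$. A Borel measure $\mu$ on $M$ is $\mathcal E$-dominant if it is $\sigma$-finite and $\boldsymbol\mu_f\ll\mu$ for every $f\in\mathcal F$ (hence for every $f\in\mathcal F_e$); then $\Gamma_\mu(f,g):=d\boldsymbol\mu_{f,g}/d\mu\in L^1(M,\mu)$, $\Gamma_\mu(f):=\Gamma_\mu(f,f)$. Modules (with respect to $\mu$). An $L^p$-normed $L^\infty$-module is a real Banach space $\mathcal M$ with a bilinear multiplication $L^\infty(M,\mu)\times\mathcal M\to\mathcal M$ satisfying $(fg)v=f(gv)$, $1_Mv=v$, and a nonnegatively valued pointwise norm $|\cdot|_\mu:\mathcal M\to L^p(M,\mu)$ with $|fv|_\mu=|f||v|_\mu$ $\mu$-a.e. and $\|v\|_{\mathcal M}=\||v|_\mu\|_{L^p(M,\mu)}$. A module morphism is a bounded linear map $T$ with $T(fv)=fT(v)$ for $f\in L^\infty(M,\mu)$; a module isomorphism is a module morphism having an inverse module morphism. For $\mathcal V\subset\mathcal M$, $\mathrm{span}\,\mathcal V$ is the set of $v\in\mathcal M$ for which there is a partition $(E_k)_{k\in\mathbb N}$ of $M$ into $\mu$-measurable sets such that each $1_{E_k}v$ is a finite $L^\infty(M,\mu)$-linear combination of elements of $\mathcal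 V$; $\mathcal V$ generates $\mathcal M$ if $\mathrm{span}\,\mathcal V$ is dense in $\mathcal M$. Cotangent module. $\mathrm{Pcm}$ is the set of sequences $(f_i,A_i)_{i\in\mathbb N}$ with $(A_i)$ a Borel partition of $M$, $f_i\in\mathcal F_e$ and $\sum_i\boldsymbol\mu_{f_i}[A_i]<\infty$; two elements $(f_i,A_i)$, $(g_j,B_j)$ are equivalent if $\boldsymbol\mu_{f_i-g_j}[A_i\cap B_j]=0$ for all $i,j$; $[f_i,A_i]$ denotes the class. The quotient is a vector space via $[f_i,A_i]+[g_j,B_j]:=[f_i+g_j,A_i\cap B_j]$, $\lambda[f_i,A_i]:=[\lambda f_i,A_i]$, with a multiplication by simple functions $h=\sum_j1_{B_j}h_j$ ($B_j$ a finite Borel partition) given by $h[f_i,A_i]:=[h_jf_i,A_i\cap B_j]$, extended by continuity to bounded functions, and with norm $\|[f_i,A_i]\|^2:=\sum_i\boldsymbol\mu_{f_i}[A_i]$. $L^2(T^*M)$ is its completion; it is an $L^2$-normed $L^\infty$-module with respect to $\mu$ with pointwise norm extending $|[f_i,A_i]|_\mu=\sum_i1_{A_i}\Gamma_\mu(f_i)^{1/2}$. The differential $d:\mathcal F_e\to L^2(T^*M)$ is $df:=[f,M]$ (the class of the sequence $(f,M),(0,\emptyset),(0,\emptyset),\dots$). *)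

(* Defs.v *)
(* Elements of function spaces are represented by functions
   [M -> R]; every notion below is invariant under a.e. equality. *)
From HB Require Import structures.
From mathcomp Require Import all_boot all_order all_algebra.
From mathcomp Require Import all_classical all_reals all_analysis.
From Stdlib Require Cantor.

Set Implicit Arguments.
Unset Strict Implicit.
Unset Printing Implicit Defensive.

Import Order.TTheory GRing.Theory Num.Theory.
Import numFieldNormedType.Exports.

Local Open Scope classical_set_scope.
Local Open Scope ring_scope.

(** Topological spaces with their Borel sigma-algebra *)

HB.mixin Record isBorel (d : measure_display) T & Topological T & Measurable d T :=
  { borel_measurableE : (measurable : set (set T)) = <<s @open T >> }.

#[short(type="borelSpaceType")]
HB.structure Definition BorelSpace (d : measure_display) :=
  { T of Topological T & Measurable d T & isBorel d T }.

Definition polish (R : realType) (P : completePseudoMetricType R) : Prop :=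
  hausdorff_space P /\ exists2 D : set P, countable D & dense D.

Definition lusin (R : realType) (T : topologicalType) : Prop :=
  exists (P : completePseudoMetricType R) (h : P -> T),
    [/\ polish P, continuous h, injective h & forall x, exists y, h y = x].

Section DirichletForm.
Context (R : realType) (d : measure_display) (M : borelSpaceType d).
Implicit Types (m : {measure set M -> \bar R}) (f g h : M -> R).

Definition full_support m : Prop :=
  forall U : set M, open U -> U !=set0 -> (0 < m U)%E.

Definition E1 m (E : (M -> R) -> (M -> R) -> R) f : R :=
  E f f + \int[m]_x (f x ^+ 2).

Record dirichlet_form m (F : set (M -> R)) (E : (M -> R) -> (M -> R) -> R)
    : Prop := {
  df_L2 : forall f, F f -> f \in Lfun m 2%:E;
  df_ae : forall f g, F f -> measurable_fun setT g -> f = g %[ae m] ->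
    F g /\ forall h, F h -> E f h = E g h;
  df_zero : F (cst 0);
  df_lin : forall (a : R) f g, F f -> F g -> F (a *: f + g);
  df_dense : forall f, f \in Lfun m 2%:E -> forall e : R, 0 < e ->
    exists2 g, F g & ('N[m]_2%:E[EFin \o (f - g)%R] < e%:E)%E;
  df_sym : forall f g, F f -> F g -> E f g = E g f;
  df_bilin : forall (a : R) f g h, F f -> F g -> F h ->
    E (a *: f + g) h = a * E f h + E g h;
  df_ge0 : forall f, F f -> 0 <= E f f;
  df_closed : forall u : nat -> M -> R, (forall n, F (u n)) ->
    (forall e : R, 0 < e -> exists N : nat, forall i j : nat,
       (N <= i)%N -> (N <= j)%N -> E1 m E (u i - u j) < e) ->
    exists2 f, F f & (fun n => E1 m E (u n - f)) @ \oo --> (0 : R);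
  df_markov : forall f, F f ->
    let f01 := (fun x => Num.min (Num.max (f x) 0) 1) in
    F f01 /\ E f01 f01 <= E f f }.

(** The (essentially) closed support of the measure [|f| m] *)
Definition msupp m f : set M :=
  ~` \bigcup_(U in [set U : set M |
      open U /\ {ae m, forall x, U x -> f x = 0}]) U.

Definition strongly_local m (F : set (M -> R)) (E : (M -> R) -> (M -> R) -> R)
    : Prop :=
  forall f g (c : R) (U : set M), F f -> F g -> open U -> msupp m f `<=` U ->
    {ae m, forall x, U x -> g x = c} -> E f g = 0.

Definition E1_dense_in m (F : set (M -> R)) (E : (M -> R) -> (M -> R) -> R)
    (D : set (M -> R)) : Prop :=
  D `<=` F /\ forall f, F f -> forall e : R, 0 < e ->
    exists2 g, D g & E1 m E (f - g) < e.

Definition nest m (F : set (M -> R)) (E : (M -> R) -> (M -> R) -> R)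
    (K : nat -> set M) : Prop :=
  [/\ forall n, closed (K n), forall n, K n `<=` K n.+1 &
      E1_dense_in m F E [set f | F f /\
        exists n, {ae m, forall x, ~ K n x -> f x = 0}]].

Definition polar m (F : set (M -> R)) (E : (M -> R) -> (M -> R) -> R)
    (N : set M) : Prop :=
  exists2 K, nest m F E K & N `<=` \bigcap_n ~` K n.

Definition quasi_continuous m (F : set (M -> R))
    (E : (M -> R) -> (M -> R) -> R) f : Prop :=
  exists2 K, nest m F E K & forall n, {within K n, continuous f}.

Definition qc_version m (F : set (M -> R)) (E : (M -> R) -> (M -> R) -> R)
    f ft : Prop :=
  quasi_continuous m F E ft /\ ft = f %[ae m].

Record quasi_regular m (F : set (M -> R)) (E : (M -> R) -> (M -> R) -> R)
    : Prop := {
  qr_compact : exists2 K, nest m F E K & forall n, compact (K n);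
  qr_dense : exists2 D, E1_dense_in m F E D &
    forall f, D f -> exists ft, qc_version m F E f ft;
  qr_separate : exists (N : set M) (u ut : nat -> M -> R),
    [/\ polar m F E N, forall n, F (u n),
        forall n, qc_version m F E (u n) (ut n) &
        forall x y, ~ N x -> ~ N y -> x != y -> exists n, ut n x != ut n y] }.

(** [u] is an approximating sequence for [f], as in the definition of the
    extended domain. *)
Definition approx m (F : set (M -> R)) (E : (M -> R) -> (M -> R) -> R)
    f (u : nat -> M -> R) : Prop :=
  [/\ forall n, F (u n),
      forall e : R, 0 < e -> exists N : nat, forall i j : nat,
        (N <= i)%N -> (N <= j)%N -> E (u i - u j) (u i - u j) < e &
      {ae m, forall x, u n x @[n --> \oo] --> f x}].

Definition ext_dom m (F : set (M -> R)) (E : (M -> R) -> (M -> R) -> R)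
    : set (M -> R) :=
  [set f | measurable_fun setT f /\ exists u, approx m F E f u].

(** Integral with respect to a finite signed measure, through its Jordan
    decomposition (which does not depend on the Hahn decomposition chosen). *)
Definition charge_integral (nu : {charge set M -> \bar R}) h : R :=
  let P := cid (Hahn_decomposition nu) in
  let N := cid (svalP P) in
  \int[jordan_pos (svalP N)]_x h x - \int[jordan_neg (svalP N)]_x h x.

(** Inner regularity by compact sets of the total variation of [nu] *)
Definition radon_charge (nu : {charge set M -> \bar R}) : Prop :=
  forall A, measurable A -> forall e : R, 0 < e ->
    exists K : set M, [/\ compact K, measurable K, K `<=` A &
      forall B, measurable B -> B `<=` A `\` K -> (`|nu B| < e%:E)%E].

(** [em] is the energy measure of [(E, F)].  It is meaningful on the extended
    domain only; elsewhere its values are arbitrary.  The formula [em_def] uses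
    Borel quasi-continuous versions: these always exist, and two of them agree
    outside a polar set. *)
Record energy_measure m (F : set (M -> R)) (E : (M -> R) -> (M -> R) -> R)
    (em : (M -> R) -> (M -> R) -> {charge set M -> \bar R}) : Prop := {
  em_radon : forall f g, ext_dom m F E f -> ext_dom m F E g ->
    radon_charge (em f g);
  em_polar : forall f g, ext_dom m F E f -> ext_dom m F E g ->
    forall N, measurable N -> polar m F E N -> em f g N = 0%E;
  em_sym : forall f g, ext_dom m F E f -> ext_dom m F E g ->
    forall A, measurable A -> em f g A = em g f A;
  em_bilin : forall (a : R) f g h, ext_dom m F E f -> ext_dom m F E g ->
    ext_dom m F E h -> forall A, measurable A ->
    em (a *: f + g) h A = (a%:E * em f h A + em g h A)%E;
  em_ge0 : forall f, ext_dom m F E f ->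
    forall A, measurable A -> (0 <= em f f A)%E;
  em_def : forall f g h, F f -> F g -> F h ->
    f \in Lfun m +oo%E -> g \in Lfun m +oo%E -> h \in Lfun m +oo%E ->
    forall ht, measurable_fun setT ht -> qc_version m F E h ht ->
    2 * charge_integral (em f g) ht =
      E (f \* h) g + E (g \* h) f - E (f \* g) h;
  em_approx : forall f g u v, ext_dom m F E f -> ext_dom m F E g ->
    approx m F E f u -> approx m F E g v ->
    forall A, measurable A -> em (u n) (v n) A @[n --> \oo] --> em f g A }.

(** Sigma-finiteness is part of the type of [mu]. *)
Definition dominant (F : set (M -> R))
    (em : (M -> R) -> (M -> R) -> {charge set M -> \bar R})
    (mu : {sigma_finite_measure set M -> \bar R}) : Prop :=
  forall f, F f -> em f f `<< mu.

Definition Gamma (em : (M -> R) -> (M -> R) -> {charge set M -> \bar R})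
    (mu : {sigma_finite_measure set M -> \bar R}) f g : M -> R :=
  fun x => fine (Radon_Nikodym (em f g) mu x).

End DirichletForm.

(** [L^p]-normed [L^\infty]-modules *)

Section Modules.
Context (R : realType) (d : measure_display) (M : measurableType d)
  (mu : {measure set M -> \bar R}).

Local Notation Linf := (Lfun mu +oo%E).

(** The structure on the Banach space [X]; [lmul] is only meaningful for
    multipliers in [Linf]. *)
Record LpLinf_module (p : \bar R) (X : completeNormedModType R) := {
  lmul : (M -> R) -> X -> X;
  pnorm : X -> M -> R;
  lmul_ae : forall f g v, f \in Linf -> g \in Linf -> f = g %[ae mu] ->
    lmul f v = lmul g v;
  lmul_linl : forall (a : R) f g v, f \in Linf -> g \in Linf ->
    lmul (a *: f + g) v = a *: lmul f v + lmul g v;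
  lmul_linr : forall (a : R) f v w, f \in Linf ->
    lmul f (a *: v + w) = a *: lmul f v + lmul f w;
  lmulA : forall f g v, f \in Linf -> g \in Linf ->
    lmul (f \* g) v = lmul f (lmul g v);
  lmul1 : forall v, lmul (cst 1) v = v;
  pnorm_Lp : forall v, pnorm v \in Lfun mu p;
  pnorm_ge0 : forall v, {ae mu, forall x, 0 <= pnorm v x};
  pnormM : forall f v, f \in Linf ->
    pnorm (lmul f v) = (fun x => `|f x| * pnorm v x) %[ae mu];
  norm_pnorm : forall v, `|v|%:E = ('N[mu]_p[EFin \o pnorm v])%E }.

Definition is_module_morphism (p : \bar R) (X Y : completeNormedModType R)
    (mX : LpLinf_module p X) (mY : LpLinf_module p Y) (T : X -> Y) : Prop :=
  [/\ forall (a : R) v w, T (a *: v + w) = a *: T v + T w,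
      exists C : R, forall v, `|T v| <= C * `|v| &
      forall f v, f \in Linf -> T (lmul mX f v) = lmul mY f (T v)].

Definition is_module_isomorphism (p : \bar R) (X Y : completeNormedModType R)
    (mX : LpLinf_module p X) (mY : LpLinf_module p Y) (T : X -> Y) : Prop :=
  is_module_morphism mX mY T /\
  exists S : Y -> X,
    [/\ is_module_morphism mY mX S, cancel T S & cancel S T].

Definition is_partition (A : nat -> set M) : Prop :=
  [/\ forall k, measurable (A k), trivIset setT A & \bigcup_k A k = setT].

Definition mspan (p : \bar R) (X : completeNormedModType R)
    (mX : LpLinf_module p X) (V : set X) : set X :=
  [set v | exists2 A : nat -> set M, is_partition A &
    forall k, exists (n : nat) (h : 'I_n -> M -> R) (w : 'I_n -> X),
      [/\ forall i, h i \in Linf, forall i, V (w i) &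
          lmul mX \1_(A k) v = \sum_(i < n) lmul mX (h i) (w i)]].

Definition generates (p : \bar R) (X : completeNormedModType R)
    (mX : LpLinf_module p X) (V : set X) : Prop := dense (mspan mX V).

End Modules.

(** The cotangent module *)

Section Cotangent.
Context (R : realType) (d : measure_display) (M : borelSpaceType d).
Variables (m : {sigma_finite_measure set M -> \bar R}) (F : set (M -> R))
  (E : (M -> R) -> (M -> R) -> R)
  (em : (M -> R) -> (M -> R) -> {charge set M -> \bar R})
  (mu : {sigma_finite_measure set M -> \bar R}).

(** [a i] is the pair [(f_i, A_i)]. *)
Definition pcm_seq := nat -> (M -> R) * set M.

Definition pcm : set pcm_seq :=
  [set a | [/\ forall i, ext_dom m F E (a i).1,
     is_partition (fun i => (a i).2) &
     (\sum_(0 <= i <oo) em (a i).1 (a i).1 (a i).2 < +oo)%E]].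

Definition pcm_eq (a b : pcm_seq) : Prop :=
  forall i j, em ((a i).1 - (b j).1) ((a i).1 - (b j).1)
                 ((a i).2 `&` (b j).2) = 0%E.

(** Doubly indexed families are enumerated by the bijection
    [Cantor.of_nat : nat -> nat * nat]. *)
Definition pcm_add (a b : pcm_seq) : pcm_seq := fun k =>
  let ij := Cantor.of_nat k in
  ((a ij.1).1 + (b ij.2).1, (a ij.1).2 `&` (b ij.2).2).

Definition pcm_scale (c : R) (a : pcm_seq) : pcm_seq :=
  fun i => (c *: (a i).1, (a i).2).

(** Multiplication by the simple function [\sum_(j < n) h j * \1_(B j)], where
    [B j] is empty for [n <= j]. *)
Definition pcm_smul (h : nat -> R) (B : nat -> set M) (a : pcm_seq) : pcm_seq :=
  fun k => let ij := Cantor.of_nat k in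
  (h ij.2 *: (a ij.1).1, (a ij.1).2 `&` B ij.2).

Definition simple_fun (n : nat) (h : nat -> R) (B : nat -> set M) : M -> R :=
  fun x => \sum_(j < n) h j * \1_(B j) x.

(** [(X, mX)] with the map [cl : a |-> [a]] is a completion of the quotient of
    [pcm] by [pcm_eq], with the module structure and the pointwise norm
    extending those of the quotient. All such realizations are isomorphic. *)
Record cotangent_module (X : completeNormedModType R)
    (mX : LpLinf_module mu 2%:E X) (cl : pcm_seq -> X) : Prop := {
  cot_eq : forall a b, pcm a -> pcm b -> (cl a = cl b <-> pcm_eq a b);
  cot_add : forall a b, pcm a -> pcm b -> cl (pcm_add a b) = cl a + cl b;
  cot_scale : forall (c : R) a, pcm a -> cl (pcm_scale c a) = c *: cl a;
  cot_norm : forall a, pcm a -> (`|cl a| ^+ 2)%:E =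
    (\sum_(0 <= i <oo) em (a i).1 (a i).1 (a i).2)%E;
  cot_dense : dense (cl @` pcm);
  cot_smul : forall n h B a, is_partition B ->
    (forall j, (n <= j)%N -> B j = set0) -> pcm a ->
    lmul mX (simple_fun n h B) (cl a) = cl (pcm_smul h B a);
  cot_pnorm : forall a, pcm a ->
    {ae mu, forall x, (pnorm mX (cl a) x)%:E =
      (\sum_(0 <= i <oo) (\1_((a i).2) x *
         Num.sqrt (Gamma em mu (a i).1 (a i).1 x))%:E)%E} }.

Definition pcm_single (f : M -> R) : pcm_seq :=
  fun k => if k == 0%N then (f, setT) else (cst 0, set0).

Definition differential (X : completeNormedModType R) (cl : pcm_seq -> X)
    (f : M -> R) : X := cl (pcm_single f).

(** Linear maps on the space of [m]-a.e. classes of elements of [ext_dom] *)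
Definition linear_on_ext_dom (Y : completeNormedModType R)
    (D : (M -> R) -> Y) : Prop :=
  (forall f g, ext_dom m F E f -> ext_dom m F E g -> f = g %[ae m] ->
     D f = D g) /\
  (forall (a : R) f g, ext_dom m F E f -> ext_dom m F E g ->
     D (a *: f + g) = a *: D f + D g).

End Cotangent.

(* Main.v *)
(** Both modules carry the same data on the differentials: [|d f| = |D f|] almost
    everywhere, for the linear maps [d] and [D].  Call [x] and [y] related when,
    on the pieces of a countable partition, [x] and [y] coincide with [d f_k] and
    [D f_k] for the same functions [f_k].  This relation is linear and
    norm-preserving, and so is its closure, which is moreover stable under bounded
    multipliers, because those are uniform limits of countably valued ones.  By
    completeness the two projections of the closure are closed submodules; they
    contain the differentials, so they are everything by generation.  Hence the
    closure is the graph of an isometric module isomorphism. *)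
Require Import Defs.
From HB Require Import structures.
From mathcomp Require Import all_boot all_order all_algebra.
From mathcomp Require Import all_classical all_reals all_analysis.
From mathcomp Require Import measurable_realfun ess_sup_inf ring lra.
From Stdlib Require Cantor.

Set Implicit Arguments.
Unset Strict Implicit.
Unset Printing Implicit Defensive.

Import Order.TTheory GRing.Theory Num.Theory.
Import numFieldNormedType.Exports.

Local Open Scope classical_set_scope.
Local Open Scope ring_scope.

(** * Bounded multipliers *)

Section Linf.
Context (R : realType) (d : measure_display) (M : measurableType d)
  (mu : {measure set M -> \bar R}).
Local Notation Linf := (Lfun mu +oo%E).
Implicit Types (f g : M -> R) (A : set M).

Lemma Linf_bounded f (c : R) :
  measurable_fun setT f -> (forall x, `|f x| <= c) -> f \in Linf.
Proof.
(* The norm is an essential supremum when the whole space has positive measure, and the default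
   value [0] otherwise. *)
move=> mf fc; rewrite inE; apply/andP; split; rewrite inE//=.
rewrite /finite_norm unlock /=; case: ifPn => // _.
apply: (@le_lt_trans _ _ c%:E); last exact: ltry.
by apply/ess_supP/nearW => x /=; rewrite lee_fin.
Qed.

Lemma Linf_lin (a : R) f g : f \in Linf -> g \in Linf -> a *: f + g \in Linf.
Proof. by have [_] := @Lfun_submod_closed _ _ _ mu +oo%E (leey _); exact. Qed.

Lemma Linf_cst (c : R) : cst c \in Linf.
Proof. exact: (@Linf_bounded _ `|c|). Qed.

Lemma Linf_sub f g : f \in Linf -> g \in Linf -> f - g \in Linf.
Proof. by move=> fL gL; rewrite addrC -scaleN1r; exact: Linf_lin. Qed.

Lemma Linf_indic A : measurable A -> \1_A \in Linf.
Proof.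
move=> mA; apply: (@Linf_bounded _ 1) => [|x]; first exact/measurable_indicP.
by rewrite indicE; case: (_ \in _); rewrite ?normr1 ?normr0.
Qed.

Lemma Linf_measurable f : f \in Linf -> measurable_fun setT f.
Proof. by rewrite inE => /andP[]; rewrite inE. Qed.

End Linf.

(** * Algebra of the multiplication, and the norm as an integral *)

Section ModuleTheory.
Context (R : realType) (d : measure_display) (M : measurableType d)
  (mu : {measure set M -> \bar R}) (p : R) (p1 : 1 <= p)
  (X : completeNormedModType R) (mX : LpLinf_module mu p%:E X).
Local Notation Linf := (Lfun mu +oo%E).
Implicit Types (f g : M -> R) (A B : set M) (v w : X).

Lemma lmulZl (a : R) f v : f \in Linf -> lmul mX (a *: f) v = a *: lmul mX f v.
Proof.
move=> fL; have l0 : lmul mX 0 v = 0.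
  by rewrite -(addNr f) -scaleN1r lmul_linl// scaleN1r addNr.
by rewrite -[a *: f]addr0 lmul_linl// ?l0 ?addr0//; exact: (Linf_cst _ 0).
Qed.

Lemma lmul0l v : lmul mX 0 v = 0.
Proof. by rewrite -(scale0r (cst 1)) lmulZl ?scale0r//; exact: Linf_cst. Qed.

Lemma lmulBl f g v : f \in Linf -> g \in Linf ->
  lmul mX (f - g) v = lmul mX f v - lmul mX g v.
Proof. by move=> fL gL; rewrite addrC -scaleN1r lmul_linl// scaleN1r addrC. Qed.

Lemma lmulr0 f : f \in Linf -> lmul mX f 0 = 0.
Proof.
move=> fL; rewrite -[X in lmul _ _ X](addNr (0 : X)) -scaleN1r lmul_linr//.
by rewrite scaleN1r addNr.
Qed.

Lemma lmulZr (a : R) f v : f \in Linf -> lmul mX f (a *: v) = a *: lmul mX f v.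
Proof. by move=> fL; rewrite -[a *: v]addr0 lmul_linr// lmulr0// addr0. Qed.

Lemma lmulBr f v w : f \in Linf -> lmul mX f (v - w) = lmul mX f v - lmul mX f w.
Proof. by move=> fL; rewrite addrC -scaleN1r lmul_linr// scaleN1r addrC. Qed.

Lemma lmul_cst (c : R) v : lmul mX (cst c) v = c *: v.
Proof.
have -> : cst c = c *: cst 1 :> (M -> R).
  by apply/funext => x; exact/esym/mulr1.
by rewrite lmulZl ?lmul1//; exact: Linf_cst.
Qed.

Lemma lmul_indicI A B v : measurable A -> measurable B ->
  lmul mX \1_(A `&` B) v = lmul mX \1_A (lmul mX \1_B v).
Proof. by move=> mA mB; rewrite indicI lmulA//; exact: Linf_indic. Qed.

Lemma pnorm_measurable v : measurable_fun setT (pnorm mX v).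
Proof. by have := pnorm_Lp mX v; rewrite inE => /andP[]; rewrite inE. Qed.

Lemma norm_powR_integral v :
  (`|v| `^ p)%:E = (\int[mu]_x (`|pnorm mX v x| `^ p)%:E)%E.
Proof.
rewrite -poweR_EFin (norm_pnorm mX) poweR_Lnorm//.
by rewrite gt_eqF// (lt_le_trans ltr01).
Qed.

End ModuleTheory.

Section NormComparison.
Context (R : realType) (d : measure_display) (M : measurableType d)
  (mu : {measure set M -> \bar R}) (p : R) (p1 : 1 <= p).
Local Notation Linf := (Lfun mu +oo%E).

(** Monotonicity of the integral. The two modules may differ, so that [d f] can be compared with
    [D f]; inside a single module the lemma bounds multipliers. *)
Lemma le_norm_pnorm (X Y : completeNormedModType R) (mX : LpLinf_module mu p%:E X)
    (mY : LpLinf_module mu p%:E Y) (v : X) (w : Y) :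
  {ae mu, forall x, `|pnorm mX v x| <= `|pnorm mY w x|} -> `|v| <= `|w|.
Proof.
move=> vw; have p0 : 0 < p by rewrite (lt_le_trans ltr01).
suff : `|v| `^ p <= `|w| `^ p.
  move=> vwp; rewrite leNgt; apply/negP => wv; move: vwp; rewrite leNgt.
  by rewrite gt0_ltr_powR ?nnegrE.
rewrite -lee_fin !(norm_powR_integral p1 mX) !(norm_powR_integral p1 mY).
have mq (Z : completeNormedModType R) (mZ : LpLinf_module mu p%:E Z) z :
    measurable_fun setT (fun x => (`|pnorm mZ z x| `^ p)%:E).
  apply/measurable_EFinP; apply: (measurableT_comp (measurable_powR p)).
  by apply: measurableT_comp => //; exact: pnorm_measurable.
apply: ae_ge0_le_integral => //.
apply: filterS vw => x vw _.
by rewrite lee_fin ge0_ler_powR ?nnegrE// ltW.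
Qed.

End NormComparison.

(** * Closed submodules and generation *)

(** The enumeration is the one used by [pcm_add] and [pcm_smul], so the lemma applies directly to
    the sets that these produce. *)
Lemma partition_pair d (M : measurableType d) (A B : nat -> set M) :
  is_partition A -> is_partition B ->
  is_partition (fun k => A (Cantor.of_nat k).1 `&` B (Cantor.of_nat k).2).
Proof.
move=> [mA tA UA] [mB tB UB]; split.
- by move=> k; exact: measurableI.
- move=> i j _ _ [x [[Ai Bi] [Aj Bj]]].
  rewrite -(Cantor.cancel_to_of i) -(Cantor.cancel_to_of j).
  congr Cantor.to_nat; move: Ai Bi Aj Bj.
  case: (Cantor.of_nat i) (Cantor.of_nat j) => [i1 i2] [j1 j2] /= Ai Bi Aj Bj.
  by congr pair; [apply: tA => //|apply: tB => //]; exists x.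
- apply/seteqP; split => // x _.
  have [i _ Ai] : (\bigcup_k A k) x by rewrite UA.
  have [j _ Bj] : (\bigcup_k B k) x by rewrite UB.
  by exists (Cantor.to_nat (i, j)) => //; rewrite Cantor.cancel_of_to.
Qed.

Section ClosedSubmodule.
Context (R : realType) (d : measure_display) (M : measurableType d)
  (mu : {measure set M -> \bar R}) (p : R) (p1 : 1 <= p)
  (X : completeNormedModType R) (mX : LpLinf_module mu p%:E X).
Local Notation Linf := (Lfun mu +oo%E).

(** Dominated convergence with [|v|^p] as the dominating function; this is where the finiteness of
    [p] enters. *)
Lemma lmul_truncation (A : nat -> set M) (v : X) : is_partition A ->
  forall e : R, 0 < e ->
  exists n, `|v - lmul mX \1_(\big[setU/set0]_(i < n) A i) v| < e.
Proof.
move=> [mA tA UA] e e0; have p0 : 0 < p by rewrite (lt_le_trans ltr01).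
pose B n := \big[setU/set0]_(i < n) A i.
have mB n : measurable (B n) by apply: bigsetU_measurable.
pose w n := v - lmul mX \1_(B n) v.
have wE n : w n = lmul mX (\1_(~` B n)) v.
  rewrite /w -{1}(lmul1 mX v) -lmulBl//; [|exact: Linf_cst|exact: Linf_indic].
  congr (lmul _ _ _); apply/funext => x; rewrite !fctE !indicE in_setC.
  by case: (x \in B n); rewrite /= ?subr0 ?subrr.
have pw n : {ae mu, forall x, pnorm mX (w n) x = \1_(~` B n) x * pnorm mX v x}.
  have := pnormM mX v (Linf_indic mu (measurableC (mB n))).
  rewrite -wE; apply: filterS => x /(_ I) ->.
  by rewrite ger0_norm// indicE ler0n.
have mq z : measurable_fun setT (fun x => (`|pnorm mX z x| `^ p)%:E).
  apply/measurable_EFinP; apply: (measurableT_comp (measurable_powR p)).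
  by apply: measurableT_comp => //; exact: pnorm_measurable.
have [//|//||||_ _] := @dominated_convergence _ _ _ mu setT measurableT
  (fun n x => (`|pnorm mX (w n) x| `^ p)%:E) (cst 0%E)
  (fun x => (`|pnorm mX v x| `^ p)%:E).
(* A point of [A k] has left the complement of [B n] as soon as [n > k], so the sequence is
   eventually zero there. *)
- apply: filterS (ae_foralln pw) => x wx _.
  have [k _ Ak] : (\bigcup_k A k) x by rewrite UA.
  apply: cvg_near_cst; exists k.+1 => // n /= kn.
  rewrite wx indicE in_setC mem_set/= ?mul0r ?normr0 ?powR0 ?gt_eqF//.
  by rewrite /B -bigcup_mkord; exists k.
- exact: Lfun_integrable (pnorm_Lp mX v).
- apply: filterS (ae_foralln pw) => x wx n _.
  rewrite /= lee_fin ger0_norm ?powR_ge0//.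
  rewrite ge0_ler_powR ?nnegrE// ?(ltW p0)// wx normrM.
  by rewrite ler_piMl// indicE; case: (_ \in _); rewrite ?normr1 ?normr0.
rewrite integral0 => /fine_cvg /cvgrPdist_lt /(_ (e `^ p)).
rewrite powR_gt0// => /(_ isT) [n _ /(_ n (leqnn n))] /=.
rewrite -(norm_powR_integral p1) /= sub0r normrN ger0_norm ?powR_ge0// => wn.
exists n; rewrite ltNge; apply/negP => ewn; move: wn; rewrite ltNge.
by rewrite ge0_ler_powR ?nnegrE// ltW.
Qed.

Record closed_submodule (P : set X) : Prop := {
  csub_lin : forall (a : R) v w, P v -> P w -> P (a *: v + w);
  csub_lmul : forall f v, f \in Linf -> P v -> P (lmul mX f v);
  csub_closed : forall v, (forall e : R, 0 < e -> exists2 w, P w & `|v - w| < e) ->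
    P v }.

Lemma closed_submodule0 (P : set X) v : closed_submodule P -> P v -> P 0.
Proof. by move=> cP Pv; rewrite -(addNr v) -scaleN1r; exact: csub_lin. Qed.

(** The truncations of [v] to finitely many pieces are finite sums of elements of [P], and they
    converge to [v]. *)
Lemma closed_submodule_glue (P : set X) (A : nat -> set M) (v : X) :
  closed_submodule P -> is_partition A ->
  (forall k, P (lmul mX \1_(A k) v)) -> P v.
Proof.
move=> cP pA PA; have [mA tA _] := pA.
apply: (csub_closed cP) => e /(lmul_truncation v pA)[n vn].
exists (lmul mX \1_(\big[setU/set0]_(i < n) A i) v) => //.
elim: n {vn} => [|n IHn].
  have -> : \1_(\big[setU/set0]_(i < 0) A i) = 0 :> (M -> R).
    by rewrite big_ord0 indic0.
  by rewrite lmul0l; exact: closed_submodule0 (PA 0%N).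
(* Disjointness turns the indicator of the union into a sum; the coefficient [1] gives it the shape
   required by [lmul_linl]. *)
have -> : \1_(\big[setU/set0]_(i < n.+1) A i) =
    1 *: \1_(\big[setU/set0]_(i < n) A i) + \1_(A n) :> (M -> R).
  apply/funext => x; rewrite big_ord_recr /= !fctE scale1r !indicE in_setU.
  have [xA|xA] := boolP (x \in A n); last by rewrite orbF addr0.
  suff -> : (x \in \big[setU/set0]_(i < n) A i) = false by rewrite add0r.
  apply/negP; rewrite inE -bigcup_mkord => -[k /= kn xAk].
  move: xA; rewrite inE => xA; have kn' : k = n by apply: tA => //; exists x.
  by rewrite kn' ltnn in kn.
rewrite lmul_linl; [exact: csub_lin| |exact: Linf_indic].
by apply/Linf_indic/bigsetU_measurable.
Qed.

Lemma dense_normP (S : set X) : dense S <->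
  forall v (e : R), 0 < e -> exists2 w, S w & `|v - w| < e.
Proof.
split=> [dS v e e0|dS O [v Ov] oO].
  have [||w [vw Sw]] := dS (ball v e).
  - by exists v; exact: ballxx.
  - exact: ball_open.
  - by exists w => //; move: vw; rewrite -ball_normE.
have /nbhs_ballP[e /= e0 veO] := open_nbhs_nbhs (conj oO Ov).
have [w Sw vw] := dS v e e0.
by exists w; split => //; apply: veO; rewrite -ball_normE.
Qed.

(** Induction principle for generated modules: finite combinations of [V] lie in [P], gluing passes
    to the span, and closedness to its closure. *)
Lemma generates_ind (V P : set X) : generates mX V -> closed_submodule P ->
  V `<=` P -> P 0 -> forall v, P v.
Proof.
move=> /dense_normP gV cP VP P0 v; apply: (csub_closed cP) => e e0.
have [w [A pA wA] vw] := gV v e e0; exists w => //.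
apply: (closed_submodule_glue cP pA) => k.
have [n [h [u [hL uV ->]]]] := wA k.
elim/big_ind : _ => [|a b Pa Pb|i _].
- exact: P0.
- by rewrite -[a]scale1r; exact: csub_lin.
- by apply: csub_lmul => //; exact: VP.
Qed.

End ClosedSubmodule.

(** * Bounds, locality and step approximation of multipliers *)

Section Multipliers.
Context (R : realType) (d : measure_display) (M : measurableType d)
  (mu : {measure set M -> \bar R}) (p : R) (p1 : 1 <= p)
  (X : completeNormedModType R) (mX : LpLinf_module mu p%:E X).
Local Notation Linf := (Lfun mu +oo%E).
Implicit Types (f g h : M -> R) (A B : set M) (v w : X).

Lemma Linf_ae_bounded h : h \in Linf ->
  exists2 c : R, 0 < c & {ae mu, forall x, `|h x| <= c}.
Proof.
rewrite inE => /andP[_]; rewrite inE /= /finite_norm unlock /=.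
case: ifPn => [mu0 /ess_supr_bounded[c hc]|mu0 _].
  (* The maximum with [1] makes the bound positive, so that one can divide by it. *)
  exists (Num.max c 1); first by rewrite lt_max ltr01 orbT.
  by apply: filterS hc => x hx; rewrite le_max hx.
(* Here the whole space is null, and any bound holds almost everywhere. *)
exists 1 => //; exists setT; split => //.
by apply/eqP; rewrite eq_le measure_ge0 andbT leNgt.
Qed.

(** The right-hand side is the norm of [v] multiplied by the constant [c], so pointwise comparison
    suffices. *)
Lemma norm_lmul_le (c : R) h v : 0 <= c -> h \in Linf ->
  {ae mu, forall x, `|h x| <= c} -> `|lmul mX h v| <= c * `|v|.
Proof.
move=> c0 hL hc.
have -> : c * `|v| = `|lmul mX (cst c) v| by rewrite lmul_cst normrZ ger0_norm.
apply: (le_norm_pnorm p1 (mX := mX) (mY := mX)).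
apply: filterS3 hc (pnormM mX v hL) (pnormM mX v (Linf_cst mu c)).
move=> x hx /(_ I) -> /(_ I) ->.
by rewrite !normrM !normr_id ler_wpM2r//= (le_trans hx)// ler_norm.
Qed.

Lemma pnorm_local A v w : measurable A ->
  lmul mX \1_A v = lmul mX \1_A w ->
  {ae mu, forall x, A x -> pnorm mX v x = pnorm mX w x}.
Proof.
move=> mA vw; have := pnormM mX v (Linf_indic mu mA); rewrite vw => vA.
apply: filterS2 vA (pnormM mX w (Linf_indic mu mA)) => x /(_ I) -> /(_ I) + Ax.
by rewrite indicE mem_set//= normr1 !mul1r.
Qed.

Lemma lmul_indic_subset A B v w : measurable A -> measurable B -> A `<=` B ->
  lmul mX \1_B v = lmul mX \1_B w -> lmul mX \1_A v = lmul mX \1_A w.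
Proof.
by move=> mA mB /setIidPl <- vw; rewrite !lmul_indicI// vw.
Qed.

(** Countably many values are allowed, to match the countable partitions of [piecewise]. *)
Definition step_fun (g : M -> R) : Prop :=
  exists (B : nat -> set M) (c : nat -> R),
    is_partition B /\ forall j x, B j x -> g x = c j.

(** Rounding [h] down to a multiple of [e] gives an error below [e] and integer-indexed level
    sets. *)
Lemma Linf_step_approx h (e : R) : h \in Linf -> 0 < e ->
  exists g, [/\ g \in Linf, step_fun g & forall x, `|h x - g x| <= e].
Proof.
move=> hL e0; pose z x : int := Num.floor (h x / e).
pose g x := e * (z x)%:~R.
have mg : measurable_fun setT g.
  apply: measurable_funM => //.
  apply: (@measurableT_comp _ _ _ _ _ _ (fun t : R => (Num.floor t)%:~R : R)
    _ (fun x => h x / e)).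
    by apply: nondecreasing_measurable => // s t st; rewrite ler_int le_floor.
  by apply: measurable_funM => //; exact: Linf_measurable hL.
have hg x : `|h x - g x| <= e.
  have -> : h x - g x = e * (h x / e - (z x)%:~R).
    by rewrite mulrBr mulrCA divff ?gt_eqF// mulr1.
  have /andP[zh hz] := floor_itv (h x / e).
  rewrite normrM gtr0_norm// ler_piMr ?(ltW e0)// ger0_norm ?subr_ge0//.
  by rewrite lerBlDl ltW//; move: hz; rewrite intrD.
exists g; split => //.
- have -> : g = h - (h - g) by rewrite opprB addrC subrK.
  apply: Linf_sub => //; apply: (@Linf_bounded _ _ _ _ _ e) => //.
  by apply: measurable_funB => //; exact: Linf_measurable hL.
(* The integers are enumerated by [pickle]. A natural number that codes no integer gets the empty
   piece, so the default [0] is never taken as a value. *)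
exists (fun n => [set x | pickle (z x) = n]).
exists (fun n => e * (odflt 0 (unpickle n : option int))%:~R).
split => [|n x <-]; last by rewrite pickleK.
split.
- move=> n; have [[t <-]|nt] := pselect (exists t : int, pickle t = n).
    have -> : [set x | pickle (z x) = pickle t] = setT `&` g @^-1` [set e * t%:~R].
      rewrite setTI; apply/seteqP; split => x /=.
        by move/(pcan_inj pickleK) => zt; rewrite /g zt.
      by move/(mulfI (lt0r_neq0 e0))/intr_inj => ->.
    exact: mg.
  have -> : [set x | pickle (z x) = n] = set0; last exact: measurable0.
  by apply/seteqP; split => // x /= xn; apply: nt; exists (z x).
- by move=> i j _ _ [x [/= <- <-]].
- by apply/seteqP; split => // x _; exists (pickle (z x)).
Qed.

End Multipliers.

Definition linear_on (R : realType) (V : lmodType R) (Y : lmodType R) (U : set V)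
    (D : V -> Y) : Prop :=
  forall (a : R) f g, U f -> U g -> D (a *: f + g) = a *: D f + D g.

(** * The graph of the isomorphism *)

Lemma indic_mul_const (T : Type) (R : realType) (A : set T) (g : T -> R) (c : R) :
  (forall x, A x -> g x = c) -> \1_A \* g = c *: \1_A.
Proof.
move=> gc; apply/funext => x; rewrite fctE /= !indicE.
have [|_] := boolP (x \in A); last by rewrite mul0r scaler0.
by rewrite inE => /gc ->; exact: mulrC.
Qed.

Section PiecewiseRelation.
Context (R : realType) (d : measure_display) (M : measurableType d)
  (mu : {measure set M -> \bar R}) (p : R) (V : lmodType R) (U : set V).
Implicit Types (X Y : completeNormedModType R).

(** Asking that [x] and [y] be elements of the modules replaces the summability condition of
    [pcm]. *)
Definition piecewise X Y (mX : LpLinf_module mu p%:E X)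
    (mY : LpLinf_module mu p%:E Y) (dX : V -> X) (dY : V -> Y) (x : X) (y : Y) : Prop :=
  exists (A : nat -> set M) (f : nat -> V),
    [/\ is_partition A, forall k, U (f k),
        forall k, lmul mX \1_(A k) x = lmul mX \1_(A k) (dX (f k)) &
        forall k, lmul mY \1_(A k) y = lmul mY \1_(A k) (dY (f k))].

Definition adherent X Y (mX : LpLinf_module mu p%:E X)
    (mY : LpLinf_module mu p%:E Y) (dX : V -> X) (dY : V -> Y) (x : X) (y : Y) : Prop :=
  forall e : R, 0 < e -> exists x' y',
    [/\ piecewise mX mY dX dY x' y', `|x - x'| < e & `|y - y'| < e].

(** The inverse isomorphism thus comes from the same construction with the two modules exchanged. *)
Lemma adherent_sym X Y (mX : LpLinf_module mu p%:E X)
    (mY : LpLinf_module mu p%:E Y) (dX : V -> X) (dY : V -> Y) x y :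
  adherent mX mY dX dY x y -> adherent mY mX dY dX y x.
Proof.
move=> xy e /xy[x' [y' [[A [f [pA Uf Ax Ay]]] xx' yy']]].
by exists y', x'; split => //; exists A, f.
Qed.

Hypothesis p1 : 1 <= p.
Hypothesis U0 : U 0.
Hypothesis U_lin : forall (a : R) f g, U f -> U g -> U (a *: f + g).

Let U_scale (a : R) f : U f -> U (a *: f).
Proof. by move=> Uf; rewrite -[a *: f]addr0; exact: U_lin. Qed.

Section LinearOn.
Context (Y : lmodType R) (D : V -> Y).
Hypothesis D_lin : linear_on U D.

Lemma linear_on0 : D 0 = 0.
Proof. by rewrite -{1}(addNr 0) -scaleN1r D_lin// scaleN1r addNr. Qed.

Lemma linear_onZ (a : R) f : U f -> D (a *: f) = a *: D f.
Proof. by move=> Uf; rewrite -[a *: f]addr0 D_lin// linear_on0 addr0. Qed.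

End LinearOn.

Context (X Y : completeNormedModType R) (mX : LpLinf_module mu p%:E X)
  (mY : LpLinf_module mu p%:E Y) (dX : V -> X) (dY : V -> Y).
Hypothesis dX_lin : linear_on U dX.
Hypothesis dY_lin : linear_on U dY.
Local Notation Linf := (Lfun mu +oo%E).
Local Notation pw := (piecewise mX mY dX dY).
Local Notation adh := (adherent mX mY dX dY).

(** On the common refinement of the two partitions, the combinations [a *: f i + g j] serve both
    sides at once. *)
Lemma piecewise_lin (a : R) x y x' y' : pw x y -> pw x' y' ->
  pw (a *: x + x') (a *: y + y').
Proof.
move=> [A [f [pA Uf Ax Ay]]] [B [g [pB Ug Bx By]]].
have [mA _ _] := pA; have [mB _ _] := pB.
exists (fun k => A (Cantor.of_nat k).1 `&` B (Cantor.of_nat k).2).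
exists (fun k => a *: f (Cantor.of_nat k).1 + g (Cantor.of_nat k).2).
split; [exact: partition_pair|by move=> k; exact: U_lin| |];
  move=> k; move: (Cantor.of_nat k) => [i j] /=;
  have mAB := measurableI _ _ (mA i) (mB j);
  rewrite ?dX_lin// ?dY_lin// !lmul_linr ?(Linf_indic _ mAB)//;
  congr (_ *: _ + _).
- exact: lmul_indic_subset mAB (mA i) (@subIsetl _ _ _) (Ax i).
- exact: lmul_indic_subset mAB (mB j) (@subIsetr _ _ _) (Bx j).
- exact: lmul_indic_subset mAB (mA i) (@subIsetl _ _ _) (Ay i).
- exact: lmul_indic_subset mAB (mB j) (@subIsetr _ _ _) (By j).
Qed.

(** On [A i] intersected with [B j] the multiplier is the scalar [c j], which linearity absorbs into
    the function. A general multiplier admits no such absorption, hence the passage to the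
    closure. *)
Lemma piecewise_step g x y : g \in Linf -> step_fun g -> pw x y ->
  pw (lmul mX g x) (lmul mY g y).
Proof.
move=> gL [B [c [pB gB]]] [A [f [pA Uf Ax Ay]]].
have [mA _ _] := pA; have [mB _ _] := pB.
exists (fun k => A (Cantor.of_nat k).1 `&` B (Cantor.of_nat k).2).
exists (fun k => c (Cantor.of_nat k).2 *: f (Cantor.of_nat k).1).
split; [exact: partition_pair|by move=> k; exact: U_scale| |];
  move=> k; move: (Cantor.of_nat k) => [i j] /=;
  have mAB := measurableI _ _ (mA i) (mB j);
  have iL := Linf_indic mu mAB;
  have gE := indic_mul_const (fun x0 (ABx : (A i `&` B j) x0) => gB j x0 ABx.2);
  rewrite ?linear_onZ// -lmulA// gE lmulZl// lmulZr//; congr (_ *: _).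
- exact: lmul_indic_subset mAB (mA i) (@subIsetl _ _ _) (Ax i).
- exact: lmul_indic_subset mAB (mA i) (@subIsetl _ _ _) (Ay i).
Qed.

Lemma piecewise_diag f : U f -> pw (dX f) (dY f).
Proof.
move=> Uf; exists (fun k => if k == 0%N then setT else set0), (fun=> f).
split => //; split.
- by move=> k; case: ifP => _; [exact: measurableT|exact: measurable0].
- by move=> [|i] [|j] _ _ [x []].
- by apply/seteqP; split => // x _; exists 0%N.
Qed.

Hypothesis pnorm_dXdY : forall f, U f ->
  pnorm mX (dX f) = pnorm mY (dY f) %[ae mu].

(** On each piece both pointwise norms agree with those of [dX (f k)] and [dY (f k)], which
    coincide. *)
Lemma piecewise_norm x y : pw x y -> `|x| = `|y|.
Proof.
move=> [A [f [[mA _ UA] Uf Ax Ay]]].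
have xy : {ae mu, forall t, pnorm mX x t = pnorm mY y t}.
  have xyk : {ae mu, forall t, forall k, A k t -> pnorm mX x t = pnorm mY y t}.
    apply: ae_foralln => k.
    apply: filterS3 (pnorm_local (mA k) (Ax k)) (pnorm_local (mA k) (Ay k))
      (pnorm_dXdY (Uf k)) => t xt yt dt At.
    by rewrite (xt At) (yt At) (dt I).
  apply: filterS xyk => t xyt; have [k _ Ak] : (\bigcup_k A k) t by rewrite UA.
  exact: xyt Ak.
apply/eqP; rewrite eq_le; apply/andP; split.
  by apply: (le_norm_pnorm p1 (mX := mX) (mY := mY)); apply: filterS xy => t ->.
by apply: (le_norm_pnorm p1 (mX := mY) (mY := mX)); apply: filterS xy => t ->.
Qed.

Lemma adherent_diag f : U f -> adh (dX f) (dY f).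
Proof.
move=> Uf e e0; exists (dX f), (dY f); rewrite !subrr !normr0.
by split => //; exact: piecewise_diag.
Qed.

Lemma adherent_closed x y :
  (forall e : R, 0 < e -> exists x' y', [/\ adh x' y', `|x - x'| < e & `|y - y'| < e]) ->
  adh x y.
Proof.
move=> xy e e0; have [x1 [y1 [a1 xx1 yy1]]] := xy (e / 2) (divr_gt0 e0 (ltr0Sn _ 1)).
have [x2 [y2 [a2 xx2 yy2]]] := a1 (e / 2) (divr_gt0 e0 (ltr0Sn _ 1)).
exists x2, y2; split => //.
  by rewrite (le_lt_trans (ler_distD x1 _ _))// [ltRHS]splitr ltrD.
by rewrite (le_lt_trans (ler_distD y1 _ _))// [ltRHS]splitr ltrD.
Qed.

Lemma adherent_norm x y : adh x y -> `|x| = `|y|.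
Proof.
move=> xy; apply/eqP; rewrite -subr_eq0 -normr_le0; apply/ler_addgt0Pr => e e0.
have [x' [y' [/piecewise_norm xy' xx' yy']]] := xy (e / 2) (divr_gt0 e0 (ltr0Sn _ 1)).
have -> : `|x| - `|y| = (`|x| - `|x'|) + (`|y'| - `|y|) by rewrite xy' addrA subrK.
rewrite add0r (le_trans (ler_normD _ _))// [leRHS]splitr lerD//.
  by rewrite (le_trans (ler_dist_dist _ _))// ltW.
by rewrite distrC (le_trans (ler_dist_dist _ _))// ltW.
Qed.

Lemma adherent_lin (a : R) x y x' y' : adh x y -> adh x' y' ->
  adh (a *: x + x') (a *: y + y').
Proof.
move=> xy xy' e e0.
(* The total error is at most [|a| + 1] times the tolerance chosen for the two pairs. *)
have c0 : 0 < `|a| + 1 by rewrite ltr_wpDl.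
have n0 : 0 < e / (`|a| + 1) by rewrite divr_gt0.
have [x1 [y1 [p1' xx1 yy1]]] := xy _ n0.
have [x2 [y2 [p2 xx2 yy2]]] := xy' _ n0.
exists (a *: x1 + x2), (a *: y1 + y2); split; first exact: piecewise_lin.
  rewrite opprD addrACA -scalerBr (le_lt_trans (ler_normD _ _))//.
  rewrite normrZ -[ltRHS](divfK (lt0r_neq0 c0)) [ltRHS]mulrDr mulr1 mulrC.
  by rewrite ler_ltD// ler_wpM2r// ltW.
rewrite opprD addrACA -scalerBr (le_lt_trans (ler_normD _ _))//.
rewrite normrZ -[ltRHS](divfK (lt0r_neq0 c0)) [ltRHS]mulrDr mulr1 mulrC.
by rewrite ler_ltD// ler_wpM2r// ltW.
Qed.

(** The error [h z - g z'] splits as [h (z - z') + (h - g) z']. The pair [x'], [y'] is fixed first,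
    because the accuracy [r] of the step function [g] depends on its norm. *)
Lemma adherent_lmul h x y : h \in Linf -> adh x y ->
  adh (lmul mX h x) (lmul mY h y).
Proof.
move=> hL xy e e0; have [c c0 hc] := Linf_ae_bounded hL.
have e2 : 0 < e / 2 by rewrite divr_gt0.
have [x' [y' [pxy xx' yy']]] := xy (e / 2 / c) (divr_gt0 e2 c0).
have n0 : 0 < `|x'| + 1 by rewrite ltr_wpDl.
pose r := e / 2 / (`|x'| + 1).
have r0 : 0 < r by rewrite divr_gt0.
have [g [gL sg hg]] := Linf_step_approx hL r0.
have hgr : {ae mu, forall t, `|(h - g) t| <= r} by exact: nearW.
have bound (Z : completeNormedModType R) (mZ : LpLinf_module mu p%:E Z) z z' :
    `|z - z'| < e / 2 / c -> `|z'| = `|x'| ->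
    `|lmul mZ h z - lmul mZ g z'| < e.
  move=> zz' z'x'.
  have -> : lmul mZ h z - lmul mZ g z' = lmul mZ h (z - z') + lmul mZ (h - g) z'.
    by rewrite lmulBr// lmulBl// addrA subrK.
  rewrite (le_lt_trans (ler_normD _ _))// [ltRHS]splitr ltr_leD//.
    rewrite (le_lt_trans (norm_lmul_le p1 mZ _ (ltW c0) hL hc))//.
    by rewrite mulrC -ltr_pdivlMr.
  rewrite (le_trans (norm_lmul_le p1 mZ _ (ltW r0) (Linf_sub hL gL) hgr))//.
  by rewrite z'x' /r mulrAC ler_pdivrMr// ler_wpM2l ?(ltW e2)// lerDl.
exists (lmul mX g x'), (lmul mY g y'); split.
- exact: piecewise_step.
- exact: bound.
- by apply: bound => //; rewrite (piecewise_norm pxy).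
Qed.

(** By linearity [0] is related to [y - y'], and related elements have equal norms. *)
Lemma adherent_inj x y y' : adh x y -> adh x y' -> y = y'.
Proof.
move=> xy xy'; apply/eqP; rewrite -subr_eq0 -normr_eq0 addrC -scaleN1r.
by rewrite -(adherent_norm (adherent_lin (-1) xy' xy)) scaleN1r addNr normr0.
Qed.

(** For closedness, choose approximants of [x] together with partners. Differences of partners have
    the norms of the differences of approximants, so the partners form a Cauchy sequence, whose
    limit is a partner of [x]. *)
Lemma adherent_dom_closed : closed_submodule mX [set x | exists y, adh x y].
Proof.
split=> [a x x' [y xy] [y' xy']|h x hL [y xy]|x xP].
- by exists (a *: y + y'); exact: adherent_lin.
- by exists (lmul mY h y); exact: adherent_lmul.
have /choice[w wP] : forall n, exists wy, adh wy.1 wy.2 /\ `|x - wy.1| < n.+1%:R^-1.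
  move=> n; have [|w [y wy] xw] := xP n.+1%:R^-1; first by rewrite invr_gt0.
  by exists (w, y).
have cw : cauchy ((fun n => (w n).2) @ \oo).
  apply: cauchy_exP => e e0.
  (* The factor [2] accounts for the distances of the approximants of index [N] and [n] to [x]. *)
  have [N /= eN] : exists N, 2 * (N.+1%:R)^-1 < e :> R.
    exists (Num.truncn (2 / e)); rewrite ltr_pdivrMr// mulrC -ltr_pdivrMr//.
    exact: truncnS_gt.
  exists (w N).2; exists N => // n /= Nn; rewrite -ball_normE /=.
  have -> : `|(w N).2 - (w n).2| = `|(w N).1 - (w n).1|.
    rewrite addrC -scaleN1r -(adherent_norm (adherent_lin (-1) (wP n).1 (wP N).1)).
    by rewrite scaleN1r addrC.
  rewrite (le_lt_trans (ler_distD x _ _))// (lt_trans _ eN)// mulr_natl mulr2n.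
  rewrite distrC ltr_leD// ?(wP N).2//.
  by rewrite (le_trans (ltW (wP n).2))// lef_pV2 ?posrE// ler_nat.
have cv : cvg ((w n).2 @[n --> \oo]) by exact: cauchy_cvg.
set y := lim _ in cv.
exists y; apply: adherent_closed => e e0.
have /cvgrPdist_lt/(_ e e0)[n1 _ yn] := cv.
have [n2 /= en] : exists N, (N.+1%:R)^-1 < e :> R.
  exists (Num.truncn e^-1).
  by rewrite -[ltRHS]invrK ltf_pV2 ?posrE ?invr_gt0// truncnS_gt.
pose n := maxn n1 n2; exists (w n).1, (w n).2; split.
- exact: (wP n).1.
- rewrite (lt_trans (wP n).2)// (le_lt_trans _ en)// lef_pV2 ?posrE// ler_nat.
  by rewrite ltnS leq_maxr.
- by apply: yn; rewrite /= leq_maxl.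
Qed.

End PiecewiseRelation.

(** * Existence and uniqueness of the isomorphism, in abstract form *)

Section Isomorphism.
Context (R : realType) (d : measure_display) (M : measurableType d)
  (mu : {measure set M -> \bar R}) (p : R) (V : lmodType R) (U : set V).
Hypothesis p1 : 1 <= p.
Hypothesis U0 : U 0.
Hypothesis U_lin : forall (a : R) f g, U f -> U g -> U (a *: f + g).

Section Adherent.
Context (X Y : completeNormedModType R) (mX : LpLinf_module mu p%:E X)
  (mY : LpLinf_module mu p%:E Y) (dX : V -> X) (dY : V -> Y).
Hypothesis dX_lin : linear_on U dX.
Hypothesis dY_lin : linear_on U dY.
Hypothesis pnorm_dXdY : forall f, U f ->
  pnorm mX (dX f) = pnorm mY (dY f) %[ae mu].
Hypothesis gX : generates mX (dX @` U).
Local Notation adh := (adherent U mX mY dX dY).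

Lemma adherent_total x : exists y, adh x y.
Proof.
apply: (generates_ind p1 gX (adherent_dom_closed _ _ _ _ _ _)) => //.
- by move=> _ [f Uf <-]; exists (dY f); exact: adherent_diag.
- by exists (dY 0); rewrite -(linear_on0 U0 dX_lin); exact: adherent_diag.
Qed.

(** Each identity holds because both of its sides are partners of the same element. *)
Lemma adherent_morphism (T : X -> Y) : (forall x, adh x (T x)) ->
  is_module_morphism mX mY T.
Proof.
move=> aT; split.
- move=> a v w; apply: (adherent_inj p1 U_lin dX_lin dY_lin pnorm_dXdY (aT _)) => //.
  exact: adherent_lin.
- exists 1 => v; rewrite mul1r.
  by rewrite -(adherent_norm p1 pnorm_dXdY (aT v)).
- move=> f v fL; apply: (adherent_inj p1 U_lin dX_lin dY_lin pnorm_dXdY (aT _)) => //.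
  exact: adherent_lmul.
Qed.

(** The set where two morphisms agree is a closed submodule, and it contains the generators. *)
Lemma module_morphism_unique (S T : X -> Y) :
  is_module_morphism mX mY S -> is_module_morphism mX mY T ->
  (forall f, U f -> S (dX f) = T (dX f)) -> S = T.
Proof.
move=> [Sl [a Sa] SL] [Tl [b Tb] TL] ST; apply/funext.
have S0 : S 0 = 0 by have := Sl (-1) 0 0; rewrite !scaleN1r oppr0 addr0 addNr.
have T0 : T 0 = 0 by have := Tl (-1) 0 0; rewrite !scaleN1r oppr0 addr0 addNr.
apply: (generates_ind p1 gX (P := [set x | S x = T x])).
- split=> [c v w /= Sv Sw|f v fL /= Sv|v vP /=].
  + by rewrite Sl Tl Sv Sw.
  + by rewrite SL// TL// Sv.
  (* The bounds [a] and [b] may have any sign; [c] is positive and dominates their sum. *)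
  pose c := `|a| + `|b| + 1; have c0 : 0 < c by rewrite ltr_wpDl// addr_ge0.
  apply/eqP; rewrite -subr_eq0 -normr_le0; apply/ler_addgt0Pr => e e0.
  have [w /= Sw vw] := vP (e / c) (divr_gt0 e0 c0).
  have vE : v = 1 *: (v - w) + w by rewrite scale1r subrK.
  rewrite {1 2}vE Sl Tl Sw !scale1r opprD addrACA subrr addr0 add0r.
  rewrite (le_trans (ler_normB _ _))//.
  rewrite (le_trans (lerD (Sa _) (Tb _)))// -mulrDl.
  have cvw : c * `|v - w| <= e by rewrite mulrC -ler_pdivlMr// ltW.
  rewrite (le_trans _ cvw)// ler_wpM2r// (le_trans (lerD (ler_norm _) (ler_norm _)))//.
  by rewrite lerDl.
- by move=> _ [f Uf <-]; exact: ST.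
- by rewrite /= S0 T0.
Qed.

End Adherent.

Theorem exists_unique_isomorphism (X Y : completeNormedModType R)
    (mX : LpLinf_module mu p%:E X) (mY : LpLinf_module mu p%:E Y)
    (dX : V -> X) (dY : V -> Y) :
  linear_on U dX -> linear_on U dY ->
  (forall f, U f -> pnorm mX (dX f) = pnorm mY (dY f) %[ae mu]) ->
  generates mX (dX @` U) -> generates mY (dY @` U) ->
  exists! Phi : X -> Y,
    is_module_isomorphism mX mY Phi /\ forall f, U f -> Phi (dX f) = dY f.
Proof.
move=> lX lY XY gX gY.
have YX f : U f -> pnorm mY (dY f) = pnorm mX (dX f) %[ae mu].
  by move=> Uf; apply: filterS (XY f Uf) => t /[apply] ->.
have [Phi PhiP] := choice (adherent_total lX lY XY gX).
have [Psi PsiP] := choice (adherent_total lY lX YX gY).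
exists Phi; split.
  split; [split|].
  - exact: (adherent_morphism lX lY XY PhiP).
  - exists Psi; split; first exact: (adherent_morphism lY lX YX PsiP).
    (* Both [Psi (Phi x)] and [x] are partners of [Phi x] for the reversed relation. *)
    + move=> x; apply: (adherent_inj p1 U_lin lY lX YX (PsiP _)).
      exact: adherent_sym (PhiP x).
    + move=> y; apply: (adherent_inj p1 U_lin lX lY XY (PhiP _)).
      exact: adherent_sym (PsiP y).
  - move=> f Uf; apply: (adherent_inj p1 U_lin lX lY XY (PhiP _)).
    exact: adherent_diag.
move=> T [[mT _] TdX]; have mPhi := adherent_morphism lX lY XY PhiP.
apply: (module_morphism_unique gX mPhi mT) => f Uf.
rewrite TdX//; apply: (adherent_inj p1 U_lin lX lY XY (PhiP _)).
exact: adherent_diag.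
Qed.

End Isomorphism.

(** * The cotangent module *)

Section ExtendedDomain.
Context (R : realType) (d : measure_display) (M : borelSpaceType d)
  (m : {measure set M -> \bar R}) (F : set (M -> R))
  (E : (M -> R) -> (M -> R) -> R).
Hypothesis dfE : dirichlet_form m F E.
Local Notation ext := (ext_dom m F E).

Lemma df_subr f g : F f -> F g -> F (f - g).
Proof. by move=> Ff Fg; rewrite addrC -scaleN1r; exact: (df_lin dfE). Qed.

(** Parallelogram identity for [a *: f] and [g], after dropping the nonnegative energy of
    [- a *: f + g]. *)
Lemma form_lin_le (a : R) f g : F f -> F g ->
  E (a *: f + g) (a *: f + g) <= 2 * (a ^+ 2 * E f f + E g g).
Proof.
move=> Ff Fg; have EE (b : R) :
    E (b *: f + g) (b *: f + g) = b ^+ 2 * E f f + 2 * b * E f g + E g g.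
  have Fbfg := df_lin dfE b Ff Fg.
  rewrite (df_bilin dfE)// (df_sym dfE Ff Fbfg) (df_sym dfE Fg Fbfg).
  by rewrite !(df_bilin dfE)// (df_sym dfE Fg Ff); ring.
have := df_ge0 dfE (df_lin dfE (- a) Ff Fg); rewrite !EE; lra.
Qed.

Lemma ext_dom0 : ext 0.
Proof.
split; first exact: measurable_cst.
exists (fun=> 0); split.
- by move=> _; exact: (df_zero dfE).
- move=> e e0; exists 0%N => i j _ _.
  have E00 : E 0 0 = 0.
    have := df_bilin dfE (-1) (df_zero dfE) (df_zero dfE) (df_zero dfE).
    by rewrite -[cst 0]/(0 : M -> R) scaleN1r addNr mulN1r addNr.
  by rewrite subrr E00.
- by apply: nearW => x; exact: cvg_cst.
Qed.

Lemma ext_dom_lin (a : R) f g : ext f -> ext g -> ext (a *: f + g).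
Proof.
move=> [mf [u [Fu uC uf]]] [mg [v [Fv vC vg]]]; split.
  by apply: measurable_funD => //; exact: measurable_funM.
exists (fun n => a *: u n + v n); split.
- by move=> n; exact: (df_lin dfE).
- move=> e e0; have a0 : 0 < a ^+ 2 + 1 by rewrite ltr_wpDl// sqr_ge0.
  (* The bound [form_lin_le] then gives at most [2 * (a ^+ 2 + 1) * r = e / 2]. *)
  pose r := e / 4 / (a ^+ 2 + 1).
  have r0 : 0 < r by rewrite !divr_gt0.
  have [N1 uN] := uC r r0; have [N2 vN] := vC r r0.
  exists (maxn N1 N2) => i j; rewrite !geq_max => /andP[i1 i2] /andP[j1 j2].
  have -> : a *: u i + v i - (a *: u j + v j) = a *: (u i - u j) + (v i - v j).
    by rewrite opprD addrACA -scalerBr.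
  have Fui := df_subr (Fu i) (Fu j); have Fvi := df_subr (Fv i) (Fv j).
  rewrite (le_lt_trans (form_lin_le a Fui Fvi))//.
  have ar : (a ^+ 2 + 1) * r = e / 4 by rewrite mulrC divfK// gt_eqF.
  have arr : a ^+ 2 * E (u i - u j) (u i - u j) <= a ^+ 2 * r.
    by rewrite ler_wpM2l ?sqr_ge0// ltW// uN.
  have := vN _ _ i2 j2; lra.
- apply: filterS2 uf vg => x ux vx; rewrite fctE.
  under eq_fun do rewrite fctE.
  apply: cvgD vx; exact: cvgZr ux.
Qed.

Lemma ext_domZ (a : R) f : ext f -> ext (a *: f).
Proof.
by move=> ef; rewrite -[a *: f]addr0; apply: ext_dom_lin => //; exact: ext_dom0.
Qed.

Lemma ext_domD f g : ext f -> ext g -> ext (f + g).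
Proof. by move=> ef eg; rewrite -[f]scale1r; exact: ext_dom_lin. Qed.

Context (em : (M -> R) -> (M -> R) -> {charge set M -> \bar R}).
Hypothesis emE : energy_measure m F E em.

Lemma energy_measureZ (a : R) f (A : set M) : ext f -> measurable A ->
  em (a *: f) (a *: f) A = ((a ^+ 2)%:E * em f f A)%E.
Proof.
move=> ef mA; have e0 := ext_dom0; have em0 g : ext g -> em 0 g A = 0%E.
  move=> eg; have := em_bilin emE (-1) e0 e0 eg mA.
  by rewrite scaleN1r addNr mulN1e addeC subee// fin_num_measure.
have emZ g : ext g -> em (a *: f) g A = (a%:E * em f g A)%E.
  by move=> eg; rewrite -[a *: f]addr0 (em_bilin emE)// em0// adde0.
rewrite emZ ?(em_sym emE ef (ext_domZ a ef) mA) ?emZ ?muleA//.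
exact: ext_domZ.
Qed.

(** Equality of classes in [pcm] is checked through this dichotomy: either two pieces do not meet,
    or their indices are forced and the functions agree. *)
Lemma energy_measure_eq0 f (A : set M) : measurable A ->
  (A !=set0 -> f = 0) -> em f f A = 0%E.
Proof.
move=> mA Af; have [->|/set0P/Af ->] := eqVneq A set0; first exact: charge0.
by rewrite -(scale0r 0) energy_measureZ// ?expr0n ?mul0e//; exact: ext_dom0.
Qed.

Lemma le_energy_measure f (A B : set M) : ext f -> measurable A -> measurable B ->
  (em f f (A `&` B) <= em f f A)%E.
Proof.
move=> ef mA mB; rewrite (chargeDI _ mA mB) leeDr//.
by apply: (em_ge0 emE ef); exact: measurableD.
Qed.

End ExtendedDomain.

Lemma nneseries_head (R : realType) (u : nat -> \bar R) :
  (forall i, 0 <= u i)%E -> (forall i, i != 0%N -> u i = 0%E) ->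
  (\sum_(0 <= i <oo) u i = u 0%N)%E.
Proof.
move=> u0 uS; rewrite (nneseries_split 0 1)// add0n big_nat1 eseries0 ?adde0//.
by move=> i i1 _; apply: uS; rewrite -lt0n.
Qed.

(** * Linearity, pointwise norm and generating property of the differential *)

Section CotangentGeneration.
Context (R : realType) (d : measure_display) (M : borelSpaceType d)
  (m : {sigma_finite_measure set M -> \bar R}) (F : set (M -> R))
  (E : (M -> R) -> (M -> R) -> R)
  (em : (M -> R) -> (M -> R) -> {charge set M -> \bar R})
  (mu : {sigma_finite_measure set M -> \bar R})
  (X : completeNormedModType R) (mX : LpLinf_module mu 2%:E X)
  (cl : pcm_seq R M -> X).
Hypothesis dfE : dirichlet_form m F E.
Hypothesis emE : energy_measure m F E em.
Hypothesis cotX : cotangent_module m F E em mX cl.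
Local Notation ext := (ext_dom m F E).
Local Notation pcm := (pcm m F E em).

Let em_ge0' f A : ext f -> measurable A -> (0 <= em f f A)%E.
Proof. by move=> ef; exact: (em_ge0 emE). Qed.

Lemma partition_single : is_partition (fun k => (pcm_single (cst 0 : M -> R) k).2).
Proof.
split.
- by move=> [|k]; [exact: measurableT|exact: measurable0].
- by move=> [|i] [|j] _ _ [x []].
- by apply/seteqP; split => // x _; exists 0%N.
Qed.

Lemma pcm_single_pcm f : ext f -> pcm (pcm_single f).
Proof.
move=> ef; have e0 := ext_dom0 dfE; have ek k : ext (pcm_single f k).1 by case: k.
have [mS tS US] := partition_single.
have pS : is_partition (fun k => (pcm_single f k).2).
  by have := partition_single; congr is_partition; apply/funext => -[|k].
split => //; rewrite nneseries_head ?ltry_fin//.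
- by rewrite /= ltey_eq fin_num_measure.
- by move=> i; apply: em_ge0' => //; case: pS.
- by move=> [//|i] _; exact: charge0.
Qed.

Lemma differential_linear (a : R) f g : ext f -> ext g ->
  differential cl (a *: f + g) = a *: differential cl f + differential cl g.
Proof.
move=> ef eg; have pf := pcm_single_pcm ef; have pg := pcm_single_pcm eg.
have pfg := pcm_single_pcm (ext_dom_lin dfE a ef eg).
have paf : pcm (pcm_scale a (pcm_single f)).
  have [ek pk _] := pf; have [mk _ _] := pk.
  split => //; first by move=> i; exact: ext_domZ.
  rewrite nneseries_head.
  - by rewrite /= ltey_eq fin_num_measure.
  - by move=> i; apply: em_ge0' => //; [exact: ext_domZ|exact: mk].
  - by move=> [//|i] _; exact: charge0.
rewrite /differential -(cot_scale cotX a pf) -(cot_add cotX paf pg).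
have [eaf paaf _] := paf; have [eeg ppg _] := pg.
have pP := partition_pair paaf ppg.
have [mP _ _] := pP.
apply/(cot_eq cotX) => //.
  have eP k : ext (pcm_add (pcm_scale a (pcm_single f)) (pcm_single g) k).1.
    by apply: (ext_domD dfE); [exact: eaf|exact: eeg].
  split => //; rewrite nneseries_head.
  - by rewrite ltey_eq fin_num_measure//; exact: mP.
  - by move=> k; apply: em_ge0'; [exact: eP|exact: mP].
  - move=> k k0; apply: (energy_measure_eq0 dfE emE (mP k)) => -[x /=].
    (* The pair [(0, 0)] has code [0], so for other codes one of the two intersected sets is
       empty. *)
    rewrite -(Cantor.cancel_to_of k) in k0.
    by case: (Cantor.of_nat k) k0 => -[|i] [|j] //= _ [].
move=> i k; apply: (energy_measure_eq0 dfE emE).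
  by apply: measurableI; [case: pfg => _ [mk _ _] _; exact: mk|exact: mP].
rewrite /pcm_add; case: (Cantor.of_nat k) => -[|k1] [|k2] /= -[x []] // xi [x1 x2] //.
by case: i xi => [|i] //= _; rewrite subrr.
Qed.

Lemma pnorm_differential f : ext f ->
  pnorm mX (differential cl f) = (fun x => Num.sqrt (Gamma em mu f f x)) %[ae mu].
Proof.
move=> ef; have := cot_pnorm cotX (pcm_single_pcm ef).
apply: filterS => x + _; rewrite nneseries_head /=.
- by rewrite indicE mem_set// mul1r => -[].
- by move=> i; rewrite lee_fin mulr_ge0// ?indicE ?ler0n ?sqrtr_ge0.
- by move=> [//|i] _ /=; rewrite indic0 mul0r.
Qed.

Section Localization.
Variable A : set M.
Hypothesis mA : measurable A.

(* [\1_A] is the simple function with values [h] on the partition [B]. *)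
Let h (j : nat) : R := (j == 0%N)%:R.
Let B (j : nat) : set M := if j is j'.+1 then (if j' is 0%N then ~` A else set0) else A.

Let pB : is_partition B.
Proof.
split.
- by move=> [|[|j]] //=; exact: measurableC.
- by move=> [|[|i]] [|[|j]] _ _ [x []].
- apply/seteqP; split => // x _; have [xA|xA] := pselect (A x).
    by exists 0%N.
  by exists 1%N.
Qed.

Let pcm_restrict a : pcm a -> pcm (pcm_smul h B a).
Proof.
move=> [ea pa sa]; have [ma _ _] := pa; have [mB _ _] := pB.
have pP := partition_pair pa pB; have [mP _ _] := pP.
have eP k : ext (pcm_smul h B a k).1 by apply: (ext_domZ dfE); exact: ea.
split => //; apply: le_lt_trans sa.
pose G (i j : nat) : \bar R :=
  em (h j *: (a i).1) (h j *: (a i).1) ((a i).2 `&` B j).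
have G0 i j : (0 <= G i j)%E.
  by apply: em_ge0'; [exact: ext_domZ|exact: measurableI].
(* The terms are nonnegative, so the series may be rearranged into a double sum along the Cantor
   bijection; the inner sum keeps only [j = 0], where [h] is [1]. *)
have -> : (\sum_(0 <= k <oo) em (pcm_smul h B a k).1 (pcm_smul h B a k).1
    (pcm_smul h B a k).2 = \esum_(i in setT) \esum_(j in setT) G i j)%E.
  rewrite nneseries_esumT; last by move=> k; apply: em_ge0'; [exact: eP|exact: mP].
  rewrite esum_esum//.
  rewrite (@reindex_esum _ _ _ setT _ Cantor.of_nat)//.
  split => //.
  - by move=> x y _ _ xy; rewrite -(Cantor.cancel_to_of x) xy Cantor.cancel_to_of.
  - by move=> ij _; exists (Cantor.to_nat ij) => //; rewrite Cantor.cancel_of_to.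
rewrite nneseries_esumT; last by move=> i; apply: em_ge0'; [exact: ea|exact: ma].
apply: le_esum => i _; rewrite -nneseries_esumT// nneseries_head//.
  by rewrite /G /h /= scale1r; exact: (le_energy_measure emE).
move=> [//|j] _; rewrite /G (energy_measureZ dfE emE)//; last exact: measurableI.
by rewrite /h /= expr0n mul0e.
Qed.

(** Both sides are classes of explicit sequences. Outside [A] their functions vanish, and inside [A]
    disjointness leaves only the index [k]. *)
Lemma lmul_indic_cl a k : pcm a -> (a k).2 = A ->
  lmul mX \1_A (cl a) = lmul mX \1_A (differential cl (a k).1).
Proof.
move=> pa aA; have [ea ppa _] := pa; have [ma ta _] := ppa.
have pf := pcm_single_pcm (ea k).
have -> : \1_A = simple_fun 2 h B :> (M -> R).
  apply/funext => x; rewrite /simple_fun big_ord_recl big_ord1 /h /=.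
  by rewrite mul1r mul0r addr0.
have B2 j : (2 <= j)%N -> B j = set0 by case: j => [|[|j]].
rewrite !(cot_smul cotX)//.
have [_ [mP _ _] _] := pcm_restrict pa.
have [_ [mQ _ _] _] := pcm_restrict pf.
apply/(cot_eq cotX); [exact: pcm_restrict|exact: pcm_restrict|] => K L.
apply: (energy_measure_eq0 dfE emE); first by apply: measurableI; [exact: mP|exact: mQ].
have [_ tB _] := pB; rewrite /pcm_smul.
case: (Cantor.of_nat K) (Cantor.of_nat L) => [i j] [i' j'] /=.
move=> [x [[ai Bj] [fi Bj']]].
have jj : j = j' by apply: tB => //; exists x.
(* For [j > 0] the value of [h] is [0], so both functions are zero. *)
rewrite -jj; case: j Bj {jj Bj'} => [|j] Bj /=; last by rewrite /h /= !scale0r subrr.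
have ik : i = k by apply: ta => //; exists x; split => //; rewrite aA.
by case: i' fi => [|i'] //= _; rewrite ik subrr.
Qed.

End Localization.

(** A class [[f_i, A_i]] lies in the span, with a one-term combination on each [A_i], and these
    classes are dense. *)
Lemma differential_generates : generates mX (differential cl @` ext).
Proof.
apply/dense_normP => v e e0.
have /dense_normP/(_ v e e0)[_ [a pa <-] va] := cot_dense cotX.
exists (cl a) => //; have [ea ppa _] := pa; have [ma _ _] := ppa.
exists (fun k => (a k).2) => // k.
exists 1%N, (fun=> \1_((a k).2)), (fun=> differential cl (a k).1); split.
- by move=> _; exact: Linf_indic.
- by move=> _; exists (a k).1.
- by rewrite big_ord1; exact: lmul_indic_cl.
Qed.

End CotangentGeneration.

Theorem theorem2p9 (R : realType) (d : measure_display) (M : borelSpaceType d)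
    (m : {sigma_finite_measure set M -> \bar R})
    (F : set (M -> R)) (E : (M -> R) -> (M -> R) -> R)
    (em : (M -> R) -> (M -> R) -> {charge set M -> \bar R})
    (mu : {sigma_finite_measure set M -> \bar R})
    (X : completeNormedModType R) (mX : LpLinf_module mu 2%:E X)
    (cl : pcm_seq R M -> X)
    (Y : completeNormedModType R) (mY : LpLinf_module mu 2%:E Y)
    (D : (M -> R) -> Y) :
  lusin R M -> full_support m ->
  dirichlet_form m F E -> quasi_regular m F E -> strongly_local m F E ->
  energy_measure m F E em -> dominant F em mu ->
  cotangent_module m F E em mX cl ->
  linear_on_ext_dom m F E D ->
  generates mY (D @` ext_dom m F E) ->
  (forall f, ext_dom m F E f ->
     pnorm mY (D f) = (fun x => Num.sqrt (Gamma em mu f f x)) %[ae mu]) ->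
  exists! Phi : X -> Y,
    is_module_isomorphism mX mY Phi /\
    forall f, ext_dom m F E f -> Phi (differential cl f) = D f.
Proof.
move=> _ _ dfE _ _ emE _ cotX [_ D_lin] gY pnormD.
(* The abstract theorem is applied with [p = 2] and with the extended domain as [U]. *)
apply: (exists_unique_isomorphism (ler1n R 2) (ext_dom0 dfE)).
- by move=> a f g; exact: ext_dom_lin.
- by move=> a f g; exact: (differential_linear dfE emE cotX).
- exact: D_lin.
- move=> f ef; apply: filterS2 (pnorm_differential dfE emE cotX ef) (pnormD f ef).
  by move=> x dx Dx _; rewrite (dx I) (Dx I).
- exact: (differential_generates dfE emE cotX).
- exact: gY.
Qed.
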